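(* Let $m=a\in\mathbb S^1$ be a constant unit vector and set $n:=a^\perp=(-a_2,a_1)$. Then the projection $e\mapsto e\cdot a$ is kernel-free on $H$, i.e. $\{e\in H:e\cdot a=0\}=\{0\}$, if and only if $$k\cdot n\neq0\qquad\text{for every }k\in\mathbb Z^2\setminus\{0\}.$$ Equivalently, $n$ is not parallel to any nonzero lattice vector (element of $\mathbb Z^2\setminus\{0\}$). Thus constant directions with irrational transverse slope (slope of $n$) are kernel-free, whereas rational transverse directions admit invisible shear currents, i.e. nonzero elements $e\in H$ with $e\cdot a=0$.
   Context: $\mathbb T^2=(\mathbb R/2\pi\mathbb Z)^2$, and $H$ is the space of divergence-free (in the sense of distributions), mean-zero real vector fields in $L^2(\mathbb T^2)^2$. *)

(* Defs.v *)
From HB Require Import structures.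
From mathcomp Require Import all_boot all_order all_algebra.
From mathcomp Require Import all_classical all_reals all_analysis.
From mathcomp Require Import measurable_realfun.

Set Implicit Arguments.
Unset Strict Implicit.
Unset Printing Implicit Defensive.
Import Order.TTheory GRing.Theory Num.Theory.
Import numFieldNormedType.Exports.

Local Open Scope classical_set_scope.
Local Open Scope quotient_scope.
Local Open Scope ring_scope.

Section LspaceClass.
Context d (T : measurableType d) (R : realType).
Context (mu : {measure set T -> \bar R}).

Lemma finite_norm_ae_eq (f g : T -> R) :
  measurable_fun setT f -> measurable_fun setT g ->
  f = g %[ae mu] -> finite_norm mu 2%:R%:E f -> finite_norm mu 2%:R%:E g.
Proof.
move=> mf mg fg; rewrite /finite_norm.
suff -> : 'N[mu]_2%:R%:E[EFin \o f]%E = 'N[mu]_2%:R%:E[EFin \o g]%E by [].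
have mN (h : T -> R) : measurable_fun [set: T] h ->
    measurable_fun [set: T] ((fun x => `|(EFin \o h) x| `^ 2%:R)%E : T -> \bar R).
  move=> mh; apply: (measurableT_comp (measurable_poweR _)).
  by apply: measurableT_comp => //; exact/measurable_EFinP.
rewrite unlock /Lnorm; congr (_ `^ _)%E; apply: ge0_ae_eq_integral => //.
- exact: mN.
- exact: mN.
- by move=> x _; exact: poweR_ge0.
- by move=> x _; exact: poweR_ge0.
- by apply: (filterS _ fg) => x /= + xT => /(_ xT) ->.
Qed.

Section L2_class.
Context (f : T -> R) (f2 : f \in Lfun mu 2%:R%:E).

Let mf : measurable_fun [set: T] f.
Proof. exact/set_mem/(sub_Lfun_mfun f2). Qed.

Let F : {mfun T >-> measurableTypeR R} :=
  HB.pack f (isMeasurableFun.Build _ _ T (measurableTypeR R) f mf).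

Definition L2_class : {mfun_ mu, T >-> measurableTypeR R} := \pi F.

Lemma L2_class_ae : (L2_class : T -> R) = f %[ae mu].
Proof. by have /eqmodP/asboolP := reprK L2_class. Qed.

Lemma L2_class_finite : finite_norm mu 2%:R%:E L2_class.
Proof.
apply: (@finite_norm_ae_eq f) => //.
- exact: (measurable_funPT (repr L2_class)).
- by apply: (filterS _ L2_class_ae) => x /= + xT => /(_ xT) ->.
- by have := sub_Lfun_finLfun f2; rewrite inE.
Qed.

HB.instance Definition _ :=
  isFinLebesgue.Build _ _ _ _ _ (lee1n 2) L2_class L2_class_finite.
Definition to_L2 : LspaceType2 mu := [the LspaceType _ _ of L2_class].
End L2_class.

Lemma Lfun2_0 : (cst 0 : T -> R) \in Lfun mu 2%:R%:E.
Proof. exact: (LfunP (0 : LfunType mu (lee1n 2))). Qed.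

Definition L2_0 : LspaceType2 mu := to_L2 Lfun2_0.
End LspaceClass.

(* The torus (R / 2 pi Z)^2 is represented by its fundamental domain
   [0, 2 pi)^2: its measure is the plane Lebesgue measure restricted to that
   cell, and the smooth functions on the torus are the smooth functions on the
   plane that are 2 pi-periodic in both variables. *)
Section Torus.
Context (R : realType).

Definition torus_cell : set (measurableTypeR R * measurableTypeR R) :=
  `[0, 2 * pi[ `*` `[0, 2 * pi[.

Lemma measurable_torus_cell : measurable torus_cell.
Proof. by apply: measurableX; exact: measurable_itv. Qed.

Definition torus_measure :
    set (measurableTypeR R * measurableTypeR R) -> \bar R :=
  mrestr (@lebesgue_measure R \x @lebesgue_measure R)%E measurable_torus_cell.

HB.instance Definition _ := Measure.on torus_measure.

Definition L2torus : Type := LspaceType2 torus_measure.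

Definition doubly_periodic (phi : R * R -> R) :=
  forall x : R * R, phi (x + (2 * pi, 0)) = phi x /\
                    phi (x + (0, 2 * pi)) = phi x.

Definition partial1 (phi : R * R -> R) : R * R -> R :=
  fun x => 'D_(1, 0) phi x.

Definition partial2 (phi : R * R -> R) : R * R -> R :=
  fun x => 'D_(0, 1) phi x.

(* [true] stands for the first partial derivative, [false] for the second. *)
Definition iter_partial (s : seq bool) (phi : R * R -> R) : R * R -> R :=
  foldr (fun b psi => if b then partial1 psi else partial2 psi) phi s.

(* ['D_v] is total (a default value when there is no derivative), hence the
   explicit existence conditions. *)
Definition smooth (phi : R * R -> R) := forall s : seq bool,
  continuous (iter_partial s phi) /\
  forall x : R * R, derivable (iter_partial s phi) x (1, 0) /\
                    derivable (iter_partial s phi) x (0, 1).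

Definition mean_zero (e : L2torus * L2torus) :=
  \int[torus_measure]_x e.1 x = 0 /\ \int[torus_measure]_x e.2 x = 0.

Definition weakly_div_free (e : L2torus * L2torus) :=
  forall phi : R * R -> R, smooth phi -> doubly_periodic phi ->
  \int[torus_measure]_x (e.1 x * partial1 phi x + e.2 x * partial2 phi x) = 0.

Definition Hspace : set (L2torus * L2torus) :=
  [set e | weakly_div_free e /\ mean_zero e].

Definition field0 : L2torus * L2torus :=
  (L2_0 torus_measure, L2_0 torus_measure).

Definition dir_proj (a : R * R) (e : L2torus * L2torus) : R * R -> R :=
  fun x => e.1 x * a.1 + e.2 x * a.2.

Definition ker_proj (a : R * R) : set (L2torus * L2torus) :=
  [set e | Hspace e /\ dir_proj a e = cst 0 %[ae torus_measure]].

Definition kernel_free (a : R * R) := ker_proj a = [set field0].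

Definition perp (a : R * R) : R * R := (- a.2, a.1).

Definition lattice_vec (k : int * int) : R * R := (k.1%:~R, k.2%:~R).

Definition dot (u v : R * R) : R := u.1 * v.1 + u.2 * v.2.

Definition parallel (u v : R * R) := exists2 c : R, c != 0 & u = c *: v.

(* A vertical direction (infinite slope) counts as rational: it is the
   direction of the lattice vector (0, 1). *)
Definition rational_slope (u : R * R) := u.1 = 0 \/ rational (u.2 / u.1).

Definition irrational_slope (u : R * R) := u.1 <> 0 /\ irrational (u.2 / u.1).

End Torus.

(* Main.v *)
Require Import Defs.
From mathcomp Require Import all_boot all_order all_algebra.
From mathcomp Require Import all_classical all_reals all_analysis.
From mathcomp Require Import measurable_realfun ring lra.

Set Implicit Arguments.
Unset Strict Implicit.
Unset Printing Implicit Defensive.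
Import Order.TTheory GRing.Theory Num.Theory.
Import numFieldNormedType.Exports.

Local Open Scope classical_set_scope.
Local Open Scope ring_scope.

(** With [|a| = 1] the vectors [a] and [n = perp a] form an orthonormal frame,
    so a field [e] with [e . a = 0] is [g n], where [g = e . n].  Testing the
    weak divergence against a plane wave [cos (k . x + th)] gives
    [(k . n) \int g cos (k . x + th) = 0].  If [k . n <> 0] for every nonzero
    lattice vector [k], all nonconstant Fourier coefficients of [g] vanish, the
    constant one vanishes because [e] has mean zero, and [g = 0] by uniqueness
    of Fourier coefficients ([wave_orthogonal_ae_eq0]); this is [ker_proj_eq0].
    Conversely, if [k . n = 0] with [k] nonzero, then [cos (k . x) n] is a
    shear: for a test function [phi],
    [cos (k . x) (n . grad phi) = n . grad (cos (k . x) phi)]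
    since [n] annihilates the gradient of [cos (k . x)], and a partial
    derivative of a periodic function integrates to zero; this is
    [shear_current].

    Uniqueness of Fourier coefficients is reduced to a pi-lambda argument.  The
    polynomials [(1 - t^n)^(n 2^n)] are bounded by 1 on [[0, 1]] and converge
    there to the indicator of [t < 1/2].  Composed with an affinely rescaled
    trigonometric polynomial [p], they show that the indicator of [p < c] is a
    bounded pointwise limit of trigonometric polynomials ([trig_limit_lt]).  The
    sets with that property on the fundamental cell are closed under
    intersection and complement, and they include the half-planes [x.1 < c] and
    [x.2 < c].  Hence they form a pi-system that generates the Borel sets.  An
    integrable function that is orthogonal to every wave has integral zero on
    each of them by dominated convergence, hence on every Borel set.

    A quarter turn preserves the lattice, so [n] is orthogonal to a nonzero
    lattice vector exactly when it is parallel to one; clearing denominators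
    relates this to the slope of [n]. *)

(** * Plane waves *)

Section Waves.
Context (R : realType).
Implicit Types (k l : int * int) (th : R) (x : R * R).

(** The free phase [th] makes one family out of the sines and cosines; up to
    linear combinations it is stable under partial derivatives and products. *)
Definition wave k th : R * R -> R :=
  fun x => cos (dot (lattice_vec R k) x + th).

Lemma dotDl (u v w : R * R) : dot (u + v) w = dot u w + dot v w.
Proof. rewrite /dot /=; ring. Qed.

Lemma dotDr (u v w : R * R) : dot w (u + v) = dot w u + dot w v.
Proof. rewrite /dot /=; ring. Qed.

Lemma dotZr (c : R) (u v : R * R) : dot u (c *: v) = c * dot u v.
Proof.
rewrite /dot; have -> : (c *: v).1 = c * v.1 by [].
have -> : (c *: v).2 = c * v.2 by [].
ring.
Qed.

Lemma dotNl (u w : R * R) : dot (- u) w = - dot u w.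
Proof. rewrite /dot /=; ring. Qed.

Lemma lattice_vecD k l :
  lattice_vec R (k + l) = lattice_vec R k + lattice_vec R l.
Proof. by rewrite /lattice_vec /= !rmorphD. Qed.

Lemma lattice_vecN k : lattice_vec R (- k) = - lattice_vec R k.
Proof. by rewrite /lattice_vec /= !rmorphN. Qed.

Lemma wave_mul k l th th' x :
  wave k th x * wave l th' x =
  2^-1 * wave (k + l) (th + th') x + 2^-1 * wave (k - l) (th - th') x.
Proof.
rewrite /wave !lattice_vecD lattice_vecN !dotDl dotNl.
set u := dot _ x; set v := dot _ x.
have -> : u + v + (th + th') = (u + th) + (v + th') by ring.
have -> : u - v + (th - th') = (u + th) - (v + th') by ring.
by move: (u + th) (v + th') => p q; rewrite cosD cosB; field.
Qed.

Lemma wave_norm_le1 k th x : `|wave k th x| <= 1.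
Proof. exact: cos_max. Qed.

Lemma wave00 th : wave (0, 0) th = cst (cos th).
Proof. by apply/funext => x; rewrite /wave /dot /= !mul0r !add0r. Qed.

Lemma cos_periodz (z : int) (t : R) : cos (t + z%:~R * (2 * pi)) = cos t.
Proof.
have -> : 2 * pi = pi *+ 2 :> R by rewrite mulr_natl.
case: z => n; rewrite ?NegzE.
    by rewrite -pmulrn mulr_natl (periodicn (@cosD2pi R)).
rewrite mulrNz -pmulrn mulNr mulr_natl.
by rewrite -[in RHS](subrK (pi *+ 2 *+ n.+1) t) (periodicn (@cosD2pi R)).
Qed.

Lemma wave_periodic k th : doubly_periodic (wave k th).
Proof.
move=> x; rewrite /wave !dotDr /dot /= !mulr0 addr0 add0r.
by split; rewrite addrAC cos_periodz.
Qed.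

End Waves.

(** * Polynomial approximation of a step *)

Section Steep.
Context (R : realType).

(** For [t < 1/2] the exponent is small against [t ^- n], for [t > 1/2] it is
    large.  With exponent [2 ^ n] alone the value at [t = 1/2] would tend to
    [exp (-1)]; the factor [n] sends it to 0, so that the limit is an indicator
    everywhere on [[0, 1]]. *)
Definition steep (n : nat) (t : R) := (1 - t ^+ n) ^+ (n * 2 ^ n).

Lemma bernoulli_ge (y : R) m : -1 <= y -> 1 + m%:R * y <= (1 + y) ^+ m.
Proof.
move=> y1; elim: m => [|m IH]; first by rewrite mul0r addr0 expr0.
rewrite exprS; apply: le_trans (_ : (1 + y) * (1 + m%:R * y) <= _); last first.
  by rewrite ler_wpM2l// -lerBlDl sub0r.
have : 0 <= m%:R * (y * y) by rewrite mulr_ge0// -expr2 sqr_ge0.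
rewrite -(natr1 m); lra.
Qed.

Lemma steep_ge0 n t : 0 <= t <= 1 -> 0 <= steep n t.
Proof. by move=> /andP[t0 t1]; rewrite exprn_ge0// subr_ge0 exprn_ile1. Qed.

Lemma steep_le1 n t : 0 <= t <= 1 -> steep n t <= 1.
Proof.
move=> /andP[t0 t1]; rewrite exprn_ile1// ?subr_ge0 ?exprn_ile1//.
by rewrite gerBl exprn_ge0.
Qed.

(** With [r = s^2], Bernoulli bounds [n s^n], so that [n r^n] is at most a
    constant times [s^n]. *)
Lemma cvg_natr_expr (r : R) : 0 <= r < 1 ->
  (fun n => n%:R * r ^+ n) @ \oo --> 0.
Proof.
move=> /andP[r0 r1].
have [->|rN0] := eqVneq r 0.
  by apply: cvg_near_cst; apply: nearW => -[|n]; rewrite ?mul0r// expr0n mulr0.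
have rp : 0 < r by rewrite lt_neqAle eq_sym rN0.
pose s := Num.sqrt r.
have s0 : 0 < s by rewrite sqrtr_gt0.
have s1 : s < 1 by rewrite -[ltRHS]sqrtr1 ltr_sqrt.
have sr : r = s * s by rewrite -expr2 sqr_sqrtr.
pose d := s^-1 - 1.
have d0 : 0 < d by rewrite subr_gt0 invf_gt1.
have key n : n%:R * s ^+ n <= d^-1.
  rewrite -ler_pdivlMr ?exprn_gt0// -exprVn ler_pdivlMl//.
  have : -1 <= d by rewrite (le_trans _ (ltW d0))// lerN10.
  move=> /(bernoulli_ge n); rewrite /d subrKC -/d; lra.
apply: (@squeeze_cvgr _ _ _ _ (cst (0:R)) (fun n => d^-1 * s ^+ n)).
- apply: nearW => n; rewrite mulr_ge0 ?exprn_ge0//=.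
  by rewrite sr exprMn mulrA ler_wpM2r// exprn_ge0// ltW.
- exact: cvg_cst.
- rewrite -[X in _ --> X](mulr0 d^-1); apply: cvgMr.
  by apply: cvg_expr; rewrite gtr0_norm.
Qed.

(** By Bernoulli, [steep n t >= 1 - n (2 t)^n]. *)
Lemma steep_cvg1 (t : R) : 0 <= t < 2^-1 -> steep n t @[n --> \oo] --> (1 : R).
Proof.
move=> /andP[t0 t2].
have t1 : t <= 1 by lra.
apply: (@squeeze_cvgr _ _ _ _ (fun n => 1 - n%:R * (2 * t) ^+ n) (cst (1:R))).
- apply: nearW => n; rewrite steep_le1 ?t0// andbT.
  have := @bernoulli_ge (- t ^+ n) (n * 2 ^ n).
  rewrite natrM natrX mulrN exprMn mulrA => -> //.
  by rewrite lerN2 exprn_ile1.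
- rewrite -[X in _ --> X]subr0; apply: cvgB; first exact: cvg_cst.
  by apply: cvg_natr_expr; lra.
- exact: cvg_cst.
Qed.

Lemma steep_cvg0 (t : R) : 2^-1 <= t <= 1 -> steep n t @[n --> \oo] --> (0 : R).
Proof.
move=> /andP[t2 t1].
have t0 : 0 <= t by lra.
(* (1 - y)^m <= (1 + y)^-m <= (1 + m y)^-1 with y = t^n, and m y >= n *)
apply: (@squeeze_cvgr _ _ _ _ (cst (0:R)) (fun n => n.+1%:R^-1)).
- apply: nearW => n; rewrite steep_ge0 ?t0//=.
  set m := (n * 2 ^ n)%N; set y := t ^+ n.
  have y0 : 0 <= y by exact: exprn_ge0.
  have y1 : y <= 1 by exact: exprn_ile1.
  have ny : n.+1%:R <= (1 + y) ^+ m.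
    apply: le_trans (bernoulli_ge m _); last by lra.
    rewrite -natr1 addrC lerD2l /m natrM natrX -mulrA -exprMn.
    by rewrite ler_peMr// exprn_ege1//; lra.
  rewrite -[leRHS]mul1r ler_pdivlMr//.
  apply: (@le_trans _ _ ((1 - y) ^+ m * (1 + y) ^+ m)).
    by rewrite ler_wpM2l// exprn_ge0// subr_ge0.
  rewrite -exprMn exprn_ile1//.
    by rewrite mulr_ge0//; lra.
  have : 0 <= y * y by rewrite mulr_ge0.
  lra.
- exact: cvg_cst.
- exact: cvg_harmonic.
Qed.

End Steep.

(** * Trigonometric polynomials and the sets they approximate *)

Section TrigPoly.
Context (R : realType).
Implicit Types (k l : int * int) (th : R) (x : R * R).

Lemma measurable_wave k th :
  measurable_fun [set: measurableTypeR R * measurableTypeR R] (wave k th).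
Proof.
rewrite /wave; apply: measurableT_comp.
  by apply: continuous_measurable_fun; exact: continuous_cos.
apply: measurable_funD; last exact: measurable_cst.
by apply: measurable_funD; apply: measurable_funM;
  [exact: measurable_cst|exact: measurable_fst
  |exact: measurable_cst|exact: measurable_snd].
Qed.

Inductive trig_poly : (R * R -> R) -> Prop :=
| trig_wave c k th : trig_poly (fun x => c * wave k th x)
| trig_add p q : trig_poly p -> trig_poly q -> trig_poly (fun x => p x + q x).

Lemma trig_ext p q : p =1 q -> trig_poly p -> trig_poly q.
Proof. by move=> /funext ->. Qed.

Lemma trig_cst c : trig_poly (fun=> c).
Proof.
apply: (@trig_ext (fun x => c * wave (0, 0) 0 x)); last exact: trig_wave.
by move=> x; rewrite wave00 /= cos0 mulr1.
Qed.

Lemma trig_scale c p : trig_poly p -> trig_poly (fun x => c * p x).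
Proof.
elim=> [d k th|u v _ IHu _ IHv].
  by apply: (@trig_ext (fun x => c * d * wave k th x)) => [x|];
    [rewrite mulrA|exact: trig_wave].
by apply: (@trig_ext (fun x => c * u x + c * v x)) => [x|];
  [rewrite mulrDr|exact: trig_add].
Qed.

Lemma trig_mul p q : trig_poly p -> trig_poly q ->
  trig_poly (fun x => p x * q x).
Proof.
elim=> [c k th|u v _ IHu _ IHv] tq; last first.
  by apply: (@trig_ext (fun x => u x * q x + v x * q x)) => [x|];
    [rewrite mulrDl|apply: trig_add; [exact: IHu|exact: IHv]].
elim: tq => [d l th'|u v _ IHu _ IHv]; last first.
  by apply: (@trig_ext (fun x => c * wave k th x * u x +
                                 c * wave k th x * v x)) => [x|];
    [rewrite mulrDr|exact: trig_add].
apply: (@trig_ext (fun x => c * d * (2^-1 * wave (k + l) (th + th') x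
                                    + 2^-1 * wave (k - l) (th - th') x))).
  by move=> x; rewrite -wave_mul; ring.
by apply/trig_scale/trig_add; exact: trig_wave.
Qed.

Lemma trig_exp p n : trig_poly p -> trig_poly (fun x => p x ^+ n).
Proof.
move=> tp; elim: n => [|n IH]; first exact: (trig_cst 1).
apply: (@trig_ext (fun x => p x * p x ^+ n)) => [x|]; first by rewrite exprS.
exact: trig_mul.
Qed.

Lemma trig_onem p : trig_poly p -> trig_poly (fun x => 1 - p x).
Proof.
move=> tp; apply: (@trig_ext (fun x => 1 + (-1) * p x)) => [x|].
  by rewrite mulN1r.
by apply: trig_add; [exact: trig_cst|exact: trig_scale].
Qed.

Lemma trig_steep p n : trig_poly p -> trig_poly (fun x => steep n (p x)).
Proof. by move=> tp; apply/trig_exp/trig_onem/trig_exp. Qed.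

Lemma trig_bounded p : trig_poly p -> exists2 M, 0 < M & forall x, `|p x| <= M.
Proof.
elim=> [c k th|u v _ [M M0 uM] _ [N N0 vN]].
  exists (`|c| + 1) => [|x]; first by rewrite ltr_wpDl.
  rewrite normrM (@le_trans _ _ (`|c| * 1))//.
    by rewrite ler_wpM2l// wave_norm_le1.
  by rewrite mulr1 lerDl.
exists (M + N) => [|x]; first exact: addr_gt0.
by rewrite (le_trans (ler_normD _ _))// lerD.
Qed.

Lemma measurable_trig p : trig_poly p ->
  measurable_fun [set: measurableTypeR R * measurableTypeR R] p.
Proof.
elim=> [c k th|u v _ mu _ mv].
  by apply: measurable_funM; [exact: measurable_cst|exact: measurable_wave].
exact: measurable_funD.
Qed.

(** Convergence is asked on the fundamental cell only, because every [P n] is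
    periodic whereas [A] is an arbitrary subset of the plane.  The bounds on
    [P n] serve for dominated convergence; products and complements to 1
    preserve them. *)
Definition trig_limit (A : set (measurableTypeR R * measurableTypeR R)) :=
  measurable A /\ exists P : nat -> R * R -> R,
  [/\ forall n, trig_poly (P n), forall n x, 0 <= P n x <= 1 &
      forall x, torus_cell x -> P n x @[n --> \oo] --> (\1_A x : R)].

Lemma trig_limitI A B : trig_limit A -> trig_limit B -> trig_limit (A `&` B).
Proof.
move=> [mA [P [tP P01 PA]]] [mB [Q [tQ Q01 QB]]].
split; first exact: measurableI.
exists (fun n x => P n x * Q n x); split.
- by move=> n; exact: trig_mul.
- move=> n x; have /andP[p0 p1] := P01 n x; have /andP[q0 q1] := Q01 n x.
  by rewrite mulr_ge0// mulr_ile1.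
- by move=> x cx; rewrite indicI; apply: cvgM; [exact: PA|exact: QB].
Qed.

Lemma trig_limitC A : trig_limit A -> trig_limit (~` A).
Proof.
move=> [mA [P [tP P01 PA]]]; split; first exact: measurableC.
exists (fun n x => 1 - P n x); split.
- by move=> n; exact: trig_onem.
- by move=> n x; have := P01 n x; lra.
- move=> x cx.
  have -> : \1_(~` A) x = 1 - \1_A x :> R.
    by rewrite !indicE in_setC; case: (_ \in _); rewrite ?subrr ?subr0.
  by apply: cvgB; [exact: cvg_cst|exact: PA].
Qed.

Lemma trig_limitU A B : trig_limit A -> trig_limit B -> trig_limit (A `|` B).
Proof.
move=> tA tB; rewrite -(setCK (A `|` B)) setCU.
by apply/trig_limitC/trig_limitI; exact: trig_limitC.
Qed.

Lemma trig_limit_congr A B : measurable B ->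
  (forall x, torus_cell x -> A x <-> B x) -> trig_limit A -> trig_limit B.
Proof.
move=> mB AB [mA [P [tP P01 PA]]]; split => //; exists P; split => // x cx.
suff -> : \1_B x = \1_A x :> R by exact: PA.
rewrite !indicE; congr (_%:R); congr nat_of_bool.
by apply/idP/idP => /set_mem/AB h; apply/mem_set; apply: h.
Qed.

(** Rescale [p] affinely so that it takes values in [[0, 1]] and [c] becomes
    [1/2], then apply the steep polynomials. *)
Lemma trig_limit_lt p (c : R) : trig_poly p -> trig_limit [set x | p x < c].
Proof.
move=> tp; split.
  have := measurable_trig tp measurableT (measurable_itv `]-oo, c[).
  by rewrite setTI preimage_itvNyo.
have [M M0 pM] := trig_bounded tp.
(* |p - c| <= M + |c|, hence e |p - c| <= 1/2 *)
pose e := (2 * (M + `|c|))^-1.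
have e0 : 0 < e by rewrite invr_gt0 mulr_gt0// ltr_wpDr.
pose q x := 2^-1 + e * (p x - c).
have tq : trig_poly q.
  apply: (@trig_ext (fun x => 2^-1 + e * (p x + - c))) => //.
  apply: trig_add; first exact: trig_cst.
  by apply/trig_scale/trig_add; [|exact: trig_cst].
have q01 x : 0 <= q x <= 1.
  have : `|e * (p x - c)| <= 2^-1.
    rewrite normrM gtr0_norm// ler_pdivrMl ?mulr_gt0 ?ltr_wpDr//.
    rewrite mulrAC divff// mul1r (le_trans (ler_normB _ _))// lerD2r.
    exact: pM.
  by rewrite ler_norml /q; lra.
exists (fun n x => steep n (q x)); split.
- by move=> n; exact: trig_steep.
- by move=> n x; rewrite steep_ge0 ?steep_le1.
- move=> x _; rewrite indicE; have [pc|pc] := boolP (x \in _).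
    move/set_mem: pc => /= pc; apply: steep_cvg1.
    have := q01 x => /andP[-> _] /=.
    by rewrite /q gtrDl pmulr_rlt0// subr_lt0.
  apply: steep_cvg0; have /andP[_ ->] := q01 x; rewrite andbT /q.
  rewrite lerDl pmulr_rge0// subr_ge0 leNgt; apply/negP => h.
  by move/negP: pc; apply; exact/mem_set.
Qed.

End TrigPoly.

(** * The approximated sets generate the Borel sets *)

Section Rays.
Context (R : realType).
Local Notation plane := (measurableTypeR R * measurableTypeR R)%type.

(** Within one period, [t < c] can be read off trigonometric inequalities:
    [cos (t - c/2) - cos (c/2) = 2 sin (t/2) sin ((c - t)/2)], where
    [sin (t/2) > 0] except at [t = 0], which the second disjunct recovers, and
    [sin ((c - t)/2)] has the sign of [c - t]. *)
Lemma arc_ltP (t c : R) : 0 <= t < 2 * pi -> 0 < c <= 2 * pi ->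
  t < c <-> cos (c / 2) < cos (t - c / 2) \/ 1 <= cos t.
Proof.
move=> /andP[t0 t2] /andP[c0 c2].
move: t0; rewrite le_eqVlt => /predU1P[<-|t0].
  by rewrite cos0; split => // _; right.
have sint : 0 < sin (t / 2) by apply: sin_gt0_pi; lra.
have cost : cos t < 1.
  have -> : t = (t / 2) *+ 2 by rewrite -mulr_natr; field.
  rewrite cos_mulr2n cos2sin2 -mulr_natr.
  have : 0 < sin (t / 2) ^+ 2 by rewrite exprn_gt0.
  lra.
have E : cos (t - c / 2) - cos (c / 2) = 2 * sin (t / 2) * sin ((c - t) / 2).
  have -> : t - c / 2 = t / 2 - (c - t) / 2 by field.
  have -> : c / 2 = t / 2 + (c - t) / 2 by field.
  by rewrite cosB cosD; ring.
have -> : (cos (c / 2) < cos (t - c / 2)) = (0 < sin ((c - t) / 2)).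
  by rewrite -subr_gt0 E pmulr_rgt0// mulr_gt0.
split=> [tc|[]]; last by rewrite leNgt cost.
  by left; apply: sin_gt0_pi; lra.
apply: contraPlt => ct; apply/negP; rewrite -leNgt.
rewrite -oppr_ge0 -sinN; apply: sin_ge0_pi; lra.
Qed.

Lemma trig_limit_gt p (c : R) : trig_poly p ->
  trig_limit ([set x | c < p x] : set plane).
Proof.
move=> /(trig_scale (-1)) /(@trig_limit_lt _ _ (- c)).
by under eq_set do rewrite mulN1r ltrN2.
Qed.

Lemma trig_limit_ge p (c : R) : trig_poly p ->
  trig_limit ([set x | c <= p x] : set plane).
Proof.
move=> /(@trig_limit_lt _ _ c)/trig_limitC; congr (trig_limit _).
by apply/seteqP; split => x /=; rewrite leNgt => /negP.
Qed.

(** Here [proj] is one of the two coordinates, written as [k . x] with [k] in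
    the canonical basis of the lattice, so that [wave k] depends on it alone. *)
Lemma trig_limit_ray (k : int * int) (proj : plane -> measurableTypeR R)
    (c : R) :
  measurable_fun setT proj ->
  (forall x, torus_cell x -> 0 <= proj x < 2 * pi) ->
  (forall x, dot (lattice_vec R k) x = proj x) ->
  trig_limit [set x | proj x < c].
Proof.
move=> mproj projI projE.
have mray : measurable [set x | proj x < c].
  have := mproj measurableT _ (measurable_itv `]-oo, c[).
  by rewrite setTI preimage_itvNyo.
have [c0|c0] := leP c 0.
  apply: (@trig_limit_congr _ [set x : plane | 0 < (0 : R)]) => //.
    move=> x /projI/andP[x0 _] /=.
    by split; [rewrite ltxx|rewrite ltNge (le_trans c0)].
  exact/trig_limit_gt/(@trig_cst R 0).
have [c2|c2] := leP c (2 * pi); last first.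
  apply: (@trig_limit_congr _ [set x : plane | 0 <= (0 : R)]) => //.
    by move=> x /projI/andP[_ x2] /=; split => // _; exact: lt_trans c2.
  exact/trig_limit_ge/(@trig_cst R 0).
have wE th x : 1 * wave k th x = cos (proj x + th) by rewrite mul1r /wave projE.
apply: (@trig_limit_congr _
  ([set x | cos (c / 2) < 1 * wave k (- (c / 2)) x] `|`
   [set x | 1 <= 1 * wave k 0 x])) => //.
  move=> x /projI xI /=; rewrite !wE addr0.
  have := @arc_ltP (proj x) c xI; rewrite c0 c2 => /(_ isT) [] *; split => //.
by apply: trig_limitU; [apply: trig_limit_gt|apply: trig_limit_ge];
  exact: trig_wave.
Qed.

Lemma trig_limit_ray1 (c : R) : trig_limit [set x : plane | x.1 < c].
Proof.
apply: (@trig_limit_ray (1, 0)); first exact: measurable_fst.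
- by move=> x [/= /[!in_itv]].
- by move=> x; rewrite /dot /=; ring.
Qed.

Lemma trig_limit_ray2 (c : R) : trig_limit [set x : plane | x.2 < c].
Proof.
apply: (@trig_limit_ray (0, 1)); first exact: measurable_snd.
- by move=> x [_ /= /[!in_itv]].
- by move=> x; rewrite /dot /=; ring.
Qed.

(** The rays generate the Borel sets of the line, and preimages commute with the
    operations of a sigma-algebra. *)
Lemma sigma_preimage_rays (G : set (set plane))
    (proj : plane -> measurableTypeR R) :
  (forall c : R, G [set x | proj x < c]) ->
  forall A, measurable A -> <<s G >> (proj @^-1` A).
Proof.
move=> Gray A mA.
have {}mA : <<s @RGenInftyO.G R >> A.
  have : (@ocitv R).-sigma.-measurable A by [].
  by rewrite RGenInftyO.measurableE.
suff : <<s @RGenInftyO.G R >> `<=` [set B | <<s G >> (proj @^-1` B)] by exact.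
apply: smallest_sub; last first.
  move=> _ [c ->] /=; rewrite preimage_itvNyo; apply: sub_sigma_algebra.
  exact: Gray.
split => /=.
- by rewrite preimage_set0; exact: sigma_algebra0.
- by move=> B GB; rewrite setTD -preimage_setC; exact: sigma_algebraC.
- by move=> B GB; rewrite preimage_bigcup; exact: sigma_algebra_bigcup.
Qed.

Lemma measurable_trig_limit : @measurable _ plane = <<s @trig_limit R >>.
Proof.
apply/seteqP; split; last first.
  by apply: smallest_sub; [exact: sigma_algebra_measurable|move=> A []].
rewrite measurable_prod_measurableType.
apply: smallest_sub; first exact: smallest_sigma_algebra.
move=> _ [A mA [B mB <-]].
have -> : A `*` B = (fst @^-1` A) `&` (snd @^-1` B) :> set plane by [].
rewrite -(setCK (_ `&` _)) setCI; apply: sigma_algebraC.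
rewrite -bigcup2E; apply: sigma_algebra_bigcup => -[|[|i]] /=.
- apply: sigma_algebraC; apply: sigma_preimage_rays => [c|]; last exact: mA.
  exact: trig_limit_ray1.
- apply: sigma_algebraC; apply: sigma_preimage_rays => [c|]; last exact: mB.
  exact: trig_limit_ray2.
- exact: sigma_algebra0.
Qed.

End Rays.

(** * Uniqueness of Fourier coefficients *)

Section Uniqueness.
Context (R : realType).
Local Notation plane := (measurableTypeR R * measurableTypeR R)%type.
Local Notation tau := (@torus_measure R).

Lemma torus_measureT : tau setT = ((2 * pi) * (2 * pi))%:E.
Proof.
rewrite /torus_measure /mrestr setTI /torus_cell.
rewrite product_measure1E; [|exact: measurable_itv..].
have pi2 : (0 : R) < 2 * pi by rewrite mulr_gt0// pi_gt0.
have I : @lebesgue_measure R `[0, 2 * pi[ = (2 * pi)%:E.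
  by rewrite lebesgue_measure_itv /= lte_fin pi2 sube0.
by rewrite [X in (X * X)%E]I EFinM.
Qed.

Lemma torus_measure_fin : (tau setT < +oo)%E.
Proof. by rewrite torus_measureT ltry. Qed.

Lemma ae_torus_cell : {ae tau, forall x, torus_cell x}.
Proof.
exists (~` @torus_cell R); split => //.
- by apply: measurableC; exact: measurable_torus_cell.
- by rewrite /= /torus_measure /mrestr setICl measure0.
Qed.

Lemma integrable_bounded (h : plane -> R) (M : R) :
  measurable_fun setT h -> (forall x, `|h x| <= M) ->
  tau.-integrable setT (EFin \o h).
Proof.
move=> mh hM; apply: measurable_bounded_integrable => //.
  exact: torus_measure_fin.
exists M; split; first exact: num_real.
by move=> N MN x _ /=; rewrite (le_trans (hM x))// ltW.
Qed.

Lemma integrable_mul_bounded (g h : plane -> R) (M : R) :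
  tau.-integrable setT (EFin \o g) ->
  measurable_fun setT h -> (forall x, `|h x| <= M) ->
  tau.-integrable setT (EFin \o (fun x => g x * h x)).
Proof.
move=> ig mh hM.
have -> : EFin \o (fun x => g x * h x) = ((EFin \o g) \* (EFin \o h))%E by [].
apply: integrableMl => //.
exists M; split; first exact: num_real.
by move=> N MN x _ /=; rewrite (le_trans (hM x))// ltW.
Qed.

Lemma integrable_mul_trig (g p : plane -> R) :
  tau.-integrable setT (EFin \o g) -> trig_poly p ->
  tau.-integrable setT (EFin \o (fun x => g x * p x)).
Proof.
move=> ig tp; have [M _ pM] := trig_bounded tp.
by apply: (integrable_mul_bounded ig _ pM); exact: measurable_trig.
Qed.

Lemma trig_limitT : trig_limit (setT : set plane).
Proof.
have := @trig_limit_ge R _ 0 (trig_cst 0).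
by congr (trig_limit _); apply/seteqP; split => x //=; rewrite lexx.
Qed.

Section Orthogonal.
Variable g : plane -> R.
Hypothesis ig : tau.-integrable setT (EFin \o g).
Hypothesis g_wave : forall k th, \int[tau]_x (g x * wave k th x) = 0.

Lemma orthogonal_trig p : trig_poly p -> \int[tau]_x (g x * p x) = 0.
Proof.
elim=> [c k th|u v tu IHu tv IHv].
  under eq_Rintegral do rewrite mulrCA.
  rewrite RintegralZl// ?g_wave ?mulr0//.
  have := integrable_mul_trig ig (trig_wave 1 k th).
  by congr (integrable _ _ _); apply/funext => x /=; rewrite mul1r.
under eq_Rintegral do rewrite mulrDr.
by rewrite RintegralD// ?IHu ?IHv ?addr0//; exact: integrable_mul_trig.
Qed.

(** The integral over [A] is the limit of the integrals against the
    approximating trigonometric polynomials; [|g|] dominates. *)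
Lemma orthogonal_trig_limit A : trig_limit A ->
  (\int[tau]_(x in A) (g x)%:E = 0)%E.
Proof.
move=> [mA [P [tP P01 PA]]].
have P_le1 n x : `|P n x| <= 1 by have /andP[? ?] := P01 n x; rewrite ger0_norm.
have mg : measurable_fun setT g.
  by apply/measurable_EFinP; exact: measurable_int ig.
have mgP n : measurable_fun setT (fun x => g x * P n x).
  by apply: measurable_funM => //; exact: measurable_trig.
have cvg_gP : (\int[tau]_x (g x * P n x)%:E)%E @[n --> \oo] -->
    (\int[tau]_x (g x * \1_A x)%:E)%E.
  have [|||||_ _ //] := @dominated_convergence _ _ _ tau setT measurableT
      (fun n x => (g x * P n x)%:E) (fun x => (g x * \1_A x)%:E)
      (fun x => `|(g x)%:E|%E).
  - by move=> n; exact/measurable_EFinP.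
  - by apply/measurable_EFinP/measurable_funM => //; exact: measurable_indic.
  - apply: filterS ae_torus_cell => x cx _; apply: cvg_EFin.
      exact: nearW.
    by apply: cvgM; [exact: cvg_cst|exact: PA].
  - exact: integrable_abse.
  - apply: aeW => x n _ /=; rewrite lee_fin normrM.
    by rewrite ler_piMr.
have gP0 n : (\int[tau]_x (g x * P n x)%:E)%E = 0%E.
  rewrite -(@fineK _ (\int[tau]_x (g x * P n x)%:E)%E).
    by rewrite -/(Rintegral _ _ _) orthogonal_trig.
  by apply: integrable_fin_num => //; exact: integrable_mul_trig.
rewrite integral_mkcond.
transitivity (\int[tau]_x (g x * \1_A x)%:E)%E.
  apply: eq_integral => x _; rewrite patchE indicE.
  by case: (x \in A); rewrite ?mulr1 ?mulr0.
have := cvg_lim (@ereal_hausdorff R) cvg_gP => <-.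
under eq_fun do rewrite gP0.
by apply: cvg_lim => //; exact: cvg_cst.
Qed.

(** The sets on which [g] has integral zero form a Dynkin system that contains a
    pi-system generating the Borel sets, so they are all the Borel sets. *)
Lemma wave_orthogonal_ae_eq0 : g = cst 0 %[ae tau].
Proof.
have g0 A : measurable A -> (\int[tau]_(x in A) (g x)%:E = 0)%E.
  have igA B : measurable B -> tau.-integrable B (EFin \o g).
    by move=> mB; apply: integrableS ig.
  rewrite measurable_trig_limit.
  move: A; apply: dynkin_induction.
  - exact: measurable_trig_limit.
  - by move=> *; exact: trig_limitI.
  - by apply: orthogonal_trig_limit; exact: trig_limitT.
  - exact: orthogonal_trig_limit.
  - move=> B mB B0.
    have : (\int[tau]_(x in B `|` ~` B) (g x)%:E = 0)%E.
      by rewrite setUv orthogonal_trig_limit//; exact: trig_limitT.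
    rewrite integral_setU ?B0 ?add0r//; first exact: measurableC.
      by rewrite setUv; exact: measurable_int ig.
    by apply/disj_setPCl.
  - move=> F mF tF F0; rewrite integral_bigcup//.
      by apply: eseries0 => n _ _; exact: F0.
    by apply: igA; exact: bigcupT_measurable.
have : ae_eq tau setT (EFin \o g) (EFin \o cst 0).
  apply: integral_ae_eq => //.
    exact/measurable_EFinP.
  by move=> E _ mE; rewrite g0// integral0.
by apply: filterS => x /= + xT => /(_ xT) [].
Qed.
End Orthogonal.
End Uniqueness.

(** * Derivatives of waves *)

Section DirectionalDerivative.
Context (R : realType).
Implicit Types (f : R * R -> R) (x v : R * R).

(** Reduces directional derivatives to derivatives of functions of one real
    variable, for which the chain rule and the fundamental theorem of calculus
    are available. *)
Lemma is_derive_line f x v (t d : R) :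
  is_derive t 1 (fun s : R => f (x + s *: v)) d <->
  is_derive (x + t *: v) v f d.
Proof.
have E : (fun h : R => h^-1 *: (((fun s : R => f (x + s *: v)) \o shift t)
                                  (h *: (1 : R)) - f (x + t *: v))) =
         (fun h : R => h^-1 *: ((f \o shift (x + t *: v)) (h *: v) -
                                f (x + t *: v))).
  apply/funext => h /=; congr (_ *: (f _ - _)).
  by rewrite [h%:A]mulr1 scalerDl addrCA.
by split=> -[df <-]; constructor; rewrite ?/derivable ?/derive E in df *.
Qed.

Lemma is_derive_wave (c : R) k th x v :
  is_derive x v (fun y => c * wave k th y)
    (c * dot (lattice_vec R k) v * wave k (th + pi / 2) x).
Proof.
have -> : x = x + 0 *: v by rewrite scale0r addr0.
apply/is_derive_line; rewrite scale0r addr0.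
set A := dot (lattice_vec R k) x + th; set B := dot (lattice_vec R k) v.
have -> : (fun s : R => c * wave k th (x + s *: v)) =
          c \*: (cos \o (cst A + B \*: id)).
  apply/funext => s /=; rewrite /wave dotDr dotZr; congr (c * cos _).
  by rewrite [RHS]/GRing.add /= /A /B [X in _ = _ + X]/GRing.scale /=; ring.
apply: is_derive_eq.
rewrite /wave addrA -/A cosDpihalf /=.
rewrite /GRing.scale /= [X in sin X]/GRing.add /=.
by rewrite [X in A + X]/GRing.scale /= mulr0 addr0; ring.
Qed.

Lemma partial1_wave (c : R) k th :
  partial1 (fun y => c * wave k th y) =
  (fun x => c * k.1%:~R * wave k (th + pi / 2) x).
Proof.
apply/funext => x; rewrite /partial1.
have [_ ->] := is_derive_wave c k th x (1, 0).
by rewrite /dot /= mulr1 mulr0 addr0.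
Qed.

Lemma partial2_wave (c : R) k th :
  partial2 (fun y => c * wave k th y) =
  (fun x => c * k.2%:~R * wave k (th + pi / 2) x).
Proof.
apply/funext => x; rewrite /partial2.
have [_ ->] := is_derive_wave c k th x (0, 1).
by rewrite /dot /= mulr1 mulr0 add0r.
Qed.

Lemma continuous_wave (c : R) k th : continuous (fun y => c * wave k th y).
Proof.
have cw : continuous (fun y : R * R => dot (lattice_vec R k) y + th).
  move=> x; apply: cvgD; last exact: cvg_cst.
  by apply: cvgD; apply: cvgM;
    [exact: cvg_cst|exact: cvg_fst|exact: cvg_cst|exact: cvg_snd].
move=> x; apply: cvgM; first exact: cvg_cst.
apply: (@continuous_comp _ _ _
  (fun y : R * R => dot (lattice_vec R k) y + th) (@cos R) x).
  exact: cw.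
exact: continuous_cos.
Qed.

(** Every iterated partial derivative of a wave is a multiple of a wave. *)
Lemma smooth_wave (c : R) k th : smooth (fun y => c * wave k th y).
Proof.
move=> s.
have [c' [th' ->]] : exists c' th', iter_partial s (fun y => c * wave k th y) =
                                    (fun y => c' * wave k th' y).
  elim: s => [|b s [c' [th' IH]]]; first by exists c, th.
  rewrite /= IH; case: b; rewrite ?partial1_wave ?partial2_wave;
    by do 2 eexists.
split; first exact: continuous_wave.
by move=> x; split; [have [] := is_derive_wave c' k th' x (1, 0)|
                     have [] := is_derive_wave c' k th' x (0, 1)].
Qed.

End DirectionalDerivative.

(** * Square-integrable functions on the torus *)

Section Lspace.
Context (R : realType).
Local Notation plane := (measurableTypeR R * measurableTypeR R)%type.
Local Notation tau := (@torus_measure R).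

Lemma measurable_L2 (e : L2torus R) : measurable_fun setT (e : plane -> R).
Proof.
exact: (measurable_funPT (repr (e : {mfun_ tau, plane >-> measurableTypeR R}))).
Qed.

Lemma integrable_L2 (e : L2torus R) :
  tau.-integrable setT (EFin \o (e : plane -> R)).
Proof.
apply/Lfun1_integrable; apply: Lfun_subset12.
  by rewrite ge0_fin_numE//; exact: torus_measure_fin.
apply/andP; split; rewrite inE; first exact: measurable_L2.
exact: Lebesgue_finite.
Qed.

Lemma L2_eq (e f : L2torus R) : (e : plane -> R) = f %[ae tau] -> e = f.
Proof.
case: e => e [[me]]; case: f => f [[mf]] /= ef.
have {}ef : e = f.
  by rewrite -[e]reprK -[f]reprK; apply/eqmodP/asboolP.
by subst f; congr LebesgueSpace.Pack; congr LebesgueSpace.Class;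
  congr isFinLebesgue.Axioms_; exact: Prop_irrelevance.
Qed.

Lemma L2_0_ae : (L2_0 tau : plane -> R) = cst 0 %[ae tau].
Proof. exact: L2_class_ae. Qed.

Lemma Rintegral_ae_eq (f g : plane -> R) : measurable_fun setT f ->
  measurable_fun setT g -> f = g %[ae tau] ->
  \int[tau]_x f x = \int[tau]_x g x.
Proof.
move=> mf mg fg; congr fine; apply: ae_eq_integral => //.
- exact/measurable_EFinP.
- exact/measurable_EFinP.
- by apply: filterS fg => x /= + xT => /(_ xT) ->.
Qed.

End Lspace.

(** * Continuous functions on the torus *)

Section ContinuousPlane.
Context (R : realType).
Local Notation plane := (measurableTypeR R * measurableTypeR R)%type.
Local Notation tau := (@torus_measure R).

(** The measurable sets of the plane are those of the product sigma-algebra, so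
    that open sets are measurable because each is a countable union of squares
    with rational center and radius. *)
Lemma continuous_plane_measurable (f : R * R -> R) : continuous f ->
  measurable_fun [set: plane] f.
Proof.
move=> cf; apply: (measurability _ (RGenOInfty.measurableE R)) => //.
move=> _ [_ [c ->] <-]; rewrite setTI preimage_itvoy.
set O := [set x | c < f x].
pose box (q1 q2 r : rat) : set plane :=
  ball (ratr q1 : R) (ratr r) `*` ball (ratr q2 : R) (ratr r).
rewrite [X in measurable X](_ : _ = \bigcup_(q1 : rat) \bigcup_(q2 : rat)
    \bigcup_(r : rat) (if `[< box q1 q2 r `<=` O >] then box q1 q2 r
                       else set0)).
  apply: bigcupT_measurable_rat => q1; apply: bigcupT_measurable_rat => q2.
  apply: bigcupT_measurable_rat => r; case: ifPn => // _.
  by apply: measurableX; exact: measurable_ball.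
apply/seteqP; split => [x Ox|x]; last first.
  by move=> [q1 _ [q2 _ [r _]]]; case: ifPn => // /asboolP; exact.
have : nbhs x O.
  apply: (@open_nbhs_nbhs (R * R)%type); split => //.
  have /continuousP/(_ `]c, +oo[%classic (interval_open _ _)) := cf.
  by rewrite preimage_itvoy; apply.
move=> /nbhs_ballP[e /= e0 xeO].
have [r] : exists r : rat, ratr r \in `]0, (e / 2) [.
  by apply: rat_in_itvoo; rewrite divr_gt0.
rewrite in_itv /= => /andP[r0 re].
have near_rat (t : R) : exists q : rat, `|ratr q - t| < ratr r.
  have [q] : exists q : rat, ratr q \in `](t - ratr r), (t + ratr r)[.
    by apply: rat_in_itvoo; lra.
  by rewrite in_itv /= => tq; exists q; rewrite ltr_distl.
have [q1 xq1] := near_rat x.1; have [q2 xq2] := near_rat x.2.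
exists q1 => //; exists q2 => //; exists r => //.
rewrite ifT; first by split.
apply/asboolP => y [y1 y2]; apply: xeO; split; rewrite /ball /=.
- rewrite (splitr e) -(subrKA (ratr q1)) (le_lt_trans (ler_normD _ _))// ltrD//.
    by rewrite distrC (lt_trans xq1).
  exact: lt_trans re.
- rewrite (splitr e) -(subrKA (ratr q2)) (le_lt_trans (ler_normD _ _))// ltrD//.
    by rewrite distrC (lt_trans xq2).
  exact: lt_trans re.
Qed.

Lemma continuous_torus_cell_bounded (f : R * R -> R) : continuous f ->
  exists M, forall x : plane, torus_cell x -> `|f x| <= M.
Proof.
move=> cf; pose Q : set (R * R) := `[0, 2 * pi] `*` `[0, 2 * pi].
have cQ : compact Q by apply: compact_setX; exact: segment_compact.
have /compact_bounded[M [_ MQ]] : compact (f @` Q).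
  by apply: continuous_compact => //; exact: continuous_subspaceT.
exists (M + 1) => x [/= x1 x2]; apply: (MQ (M + 1)); first by rewrite ltrDl.
move: x1 x2; rewrite /= !in_itv /= => /andP[a1 b1] /andP[a2 b2].
by exists x => //; split; rewrite /= in_itv /= ?a1 ?a2 ltW.
Qed.

Lemma continuous_torus_integrable (f : R * R -> R) : continuous f ->
  tau.-integrable setT (EFin \o f).
Proof.
move=> cf; have [M fM] := continuous_torus_cell_bounded cf.
have mf := continuous_plane_measurable cf.
apply/integrableP; split; first exact/measurable_EFinP.
apply: (@le_lt_trans _ _ (\int[tau]_x (cst (`|M|)%:E x))%E); last first.
  by rewrite integral_cst// lte_mul_pinfty//; exact: torus_measure_fin.
apply: ae_ge0_le_integral => //.
- by apply: measurableT_comp => //; exact/measurable_EFinP.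
- by move=> x _; rewrite lee_fin.
- apply: filterS (ae_torus_cell R) => x cx _ /=.
  by rewrite lee_fin (le_trans (fM x cx))// ler_norm.
Qed.

End ContinuousPlane.

(** * Absence of kernel without resonance *)

Section NonResonant.
Context (R : realType).
Local Notation plane := (measurableTypeR R * measurableTypeR R)%type.
Local Notation tau := (@torus_measure R).

Lemma unit_frame_decomp (a1 a2 u v : R) : a1 ^+ 2 + a2 ^+ 2 = 1 ->
  u * a1 + v * a2 = 0 ->
  u = - a2 * (- a2 * u + a1 * v) /\ v = a1 * (- a2 * u + a1 * v).
Proof.
move=> a1E uv; split.
  transitivity ((a1 ^+ 2 + a2 ^+ 2) * u - a1 * (u * a1 + v * a2)); last ring.
  by rewrite a1E uv; ring.
transitivity ((a1 ^+ 2 + a2 ^+ 2) * v - a2 * (u * a1 + v * a2)); last ring.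
by rewrite a1E uv; ring.
Qed.

(** The test function is the wave a quarter period behind, whose gradient is
    [k] times the wave. *)
Lemma weakly_div_free_wave (e : L2torus R * L2torus R) k th :
  weakly_div_free e ->
  \int[tau]_x ((k.1%:~R * e.1 x + k.2%:~R * e.2 x) * wave k th x) = 0.
Proof.
move=> /(_ (fun x => 1 * wave k (th - pi / 2) x)).
rewrite partial1_wave partial2_wave subrK => wdf; rewrite -[RHS]wdf.
- by apply: eq_Rintegral => x _; ring.
- exact: smooth_wave.
- by move=> x; have [-> ->] := @wave_periodic R k (th - pi / 2) x.
Qed.

Lemma field0_ker_proj (a : R * R) : ker_proj a (field0 R).
Proof.
have m0 := measurable_L2 (L2_0 tau).
have z0 : \int[tau]_x L2_0 tau x = 0.
  rewrite (Rintegral_ae_eq m0 (measurable_cst (0 : R)) (L2_0_ae R)).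
  by rewrite /Rintegral integral0.
split; last first.
  apply: filterS (L2_0_ae R) => x /= + xT => /(_ xT).
  by rewrite /dir_proj /= => ->; rewrite !mul0r addr0.
split; last by [].
move=> phi sphi _.
have [/continuous_plane_measurable mp1 _] := sphi [:: true].
have [/continuous_plane_measurable mp2 _] := sphi [:: false].
rewrite (@Rintegral_ae_eq _ _ (cst 0)).
- by rewrite /Rintegral integral0.
- exact: (measurable_funD (measurable_funM m0 mp1) (measurable_funM m0 mp2)).
- exact: measurable_cst.
- apply: filterS (L2_0_ae R) => x /= + xT => /(_ xT) ->.
  by rewrite !mul0r addr0.
Qed.

(** On the kernel, [e = g n] with [g = e . n], and the weak divergence condition
    reads [(k . n) \int g wave = 0]. *)
Lemma ker_proj_eq0 (a : R * R) (e : L2torus R * L2torus R) :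
  a.1 ^+ 2 + a.2 ^+ 2 = 1 ->
  (forall k : int * int, k <> (0, 0) -> dot (lattice_vec R k) (perp a) <> 0) ->
  ker_proj a e -> e = field0 R.
Proof.
move=> ha nonres [[wdf [mz1 mz2]] ea0].
have {}ea0 : \forall x \ae tau, dir_proj a e x = 0.
  by apply: (@filterS _ _ (ae_filter_ringOfSetsType tau) _ _ _ ea0) => x /(_ I).
pose g (x : plane) := - a.2 * e.1 x + a.1 * e.2 x.
have [m1 m2] := (measurable_L2 e.1, measurable_L2 e.2).
have mg : measurable_fun setT g.
  apply: measurable_funD; apply: measurable_funM => //;
    exact: measurable_cst.
have [i1 i2] := (integrable_L2 e.1, integrable_L2 e.2).
have iZ (c : R) (f : plane -> R) : tau.-integrable setT (EFin \o f) ->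
    tau.-integrable setT (EFin \o (fun x => c * f x)).
  by move=> i; have := integrableZl measurableT c i.
have ig : tau.-integrable setT (EFin \o g).
  by have := integrableD measurableT (iZ (- a.2) _ i1) (iZ a.1 _ i2).
have e1E (x : plane) : dir_proj a e x = 0 -> e.1 x = - a.2 * g x.
  by move=> /(unit_frame_decomp ha)[].
have e2E (x : plane) : dir_proj a e x = 0 -> e.2 x = a.1 * g x.
  by move=> /(unit_frame_decomp ha)[].
have g0 : g = cst 0 %[ae tau].
  apply: (wave_orthogonal_ae_eq0 ig) => k th.
  have [->|/eqP k0] := eqVneq k (0, 0).
    (* the constant mode is killed by the mean-zero condition *)
    rewrite wave00 RintegralZr// RintegralD//; [|exact: iZ..].
    by rewrite !RintegralZl// mz1 mz2 !mulr0 addr0 mul0r.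
  have mw := @measurable_wave R k th.
  have := weakly_div_free_wave k th wdf.
  rewrite (@Rintegral_ae_eq _ _
    (fun x => dot (lattice_vec R k) (perp a) * (g x * wave k th x))).
  - rewrite RintegralZl//; last first.
      by apply: (integrable_mul_bounded ig mw); exact: wave_norm_le1.
    by move=> /eqP; rewrite mulf_eq0 => /orP[/eqP/nonres|/eqP].
  - by apply: measurable_funM => //; apply: measurable_funD; apply: measurable_funM.
  - by apply: measurable_funM => //; exact: measurable_funM.
  - apply: (@filterS _ _ (ae_filter_ringOfSetsType tau) _ _ _ ea0) => x /= ex _.
    by rewrite e1E// e2E// /dot /perp /=; ring.
have z (c : R) (f : L2torus R) :
    (forall x : plane, dir_proj a e x = 0 -> f x = c * g x) -> f = L2_0 tau.
  move=> fE; apply: L2_eq.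
  have {}g0 : \forall x \ae tau, g x = 0 by apply: filterS g0 => x /(_ I).
  have f0 : \forall x \ae tau, L2_0 tau x = 0.
    by apply: filterS (L2_0_ae R) => x /(_ I).
  apply: (@filterS3 _ _ (ae_filter_ringOfSetsType tau) _ _ _ _ _ g0 ea0 f0).
  by move=> x /= gx ex zx xT; rewrite zx// fE ?gx ?ex// mulr0.
by rewrite [e]surjective_pairing (z _ _ e1E) (z _ _ e2E).
Qed.

End NonResonant.

(** * Integrals of partial derivatives of periodic functions *)

Section PeriodicPartials.
Context (R : realType).
Local Notation plane := (measurableTypeR R * measurableTypeR R)%type.
Local Notation tau := (@torus_measure R).
Local Notation leb := (@lebesgue_measure R).
Local Notation I := `[0, 2 * (pi : R)[%classic.

(** Fundamental theorem of calculus along a segment whose endpoints are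
    identified by periodicity. *)
Lemma integral_line_derive (f : R * R -> R) x v :
  continuous f -> (forall y, derivable f y v) -> continuous ('D_v f) ->
  f (x + (2 * pi) *: v) = f x ->
  (\int[leb]_(t in I) ('D_v f (x + t *: v))%:E = 0)%E.
Proof.
move=> cf df cdf per.
have pi2 : (0 : R) < 2 * pi by rewrite mulr_gt0// pi_gt0.
have cline : continuous (fun t : R => x + t *: v).
  by move=> t; apply: cvgD; [exact: cvg_cst|apply: cvgZr_tmp; exact: cvg_id].
have cfline (h : R * R -> R) : continuous h ->
    continuous (fun t : R => h (x + t *: v)).
  by move=> ch t; apply: (@continuous_comp _ _ _ (fun t : R => x + t *: v) h t);
    [exact: cline|exact: ch].
have dline (t : R) :
    is_derive t 1 (fun s : R => f (x + s *: v)) ('D_v f (x + t *: v)).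
  by apply/is_derive_line; exact: DeriveDef.
rewrite integral_itv_bndo_bndc; last first.
  apply/measurable_EFinP; apply: measurable_funTS.
  by apply: continuous_measurable_fun; exact: (cfline _ cdf).
have := @continuous_FTC2 R (fun t : R => 'D_v f (x + t *: v))
  (fun s : R => f (x + s *: v)) 0 (2 * pi) pi2.
rewrite scale0r addr0 per -EFinB subrr; apply.
- by apply: continuous_subspaceT; exact: (cfline _ cdf).
- split=> [t _| |].
  + by have [] := dline t.
  + by apply: cvg_at_right_filter; exact: (cfline _ cf).
  + by apply: cvg_at_left_filter; exact: (cfline _ cf).
- by move=> t _; rewrite derive1E; have [] := dline t.
Qed.

(** In this form Fubini's theorem for the plane Lebesgue measure applies. *)
Lemma integral_torus_measure (h : R * R -> R) : continuous h ->
  (\int[tau]_x (h x)%:E =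
   \int[leb \x leb]_x ((EFin \o h) \_ (@torus_cell R)) x)%E.
Proof.
move=> ch.
have mc := @measurable_torus_cell R.
have mh : measurable_fun [set: plane] (EFin \o h).
  by apply/measurable_EFinP; exact: continuous_plane_measurable.
transitivity (\int[tau]_x ((EFin \o h) \_ (@torus_cell R)) x)%E.
  apply: ae_eq_integral => //.
    by apply/(measurable_restrictT _ _).1 => //; exact: measurable_funTS.
  apply: (@filterS _ _ (ae_filter_ringOfSetsType tau) _ _ _ (ae_torus_cell R)).
  by move=> x cx _; rewrite patchE mem_set.
rewrite -!integral_mkcond; apply: eq_measure_integral => A mA Ac.
by rewrite /= /torus_measure /mrestr setIidl.
Qed.

Lemma integrable_cell (h : R * R -> R) : continuous h ->
  (leb \x leb)%E.-integrable setT ((EFin \o h) \_ (@torus_cell R)).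
Proof.
move=> ch.
have mc := @measurable_torus_cell R.
apply/(integrable_mkcond _ mc).
have [M hM] := continuous_torus_cell_bounded ch.
apply: measurable_bounded_integrable => //.
- by have := torus_measure_fin R; rewrite /torus_measure /mrestr setTI.
- by apply: measurable_funTS; exact: continuous_plane_measurable.
- exists M; split; first exact: num_real.
  by move=> N MN x cx /=; rewrite (le_trans (hM _ cx))// ltW.
Qed.

Lemma mem_torus_cell (x y : R) :
  ((x, y) \in @torus_cell R) = (x \in I) && (y \in I).
Proof.
apply/idP/andP => [/set_mem[/= Ix Iy]|[/set_mem Ix /set_mem Iy]].
  by split; exact/mem_set.
exact/mem_set.
Qed.

Lemma line1 (x : R * R) (t : R) : x + t *: (1, 0) = x + (t, 0).
Proof. by congr (_ + (_, _)); rewrite /= ?scaler0// [LHS]mulr1. Qed.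

Lemma line2 (x : R * R) (t : R) : x + t *: (0, 1) = x + (0, t).
Proof. by congr (_ + (_, _)); rewrite /= ?scaler0// [LHS]mulr1. Qed.

Lemma integral_partial1 (f : R * R -> R) : continuous f ->
  (forall y, derivable f y (1, 0)) -> continuous (partial1 f) ->
  doubly_periodic f -> \int[tau]_x partial1 f x = 0.
Proof.
move=> cf df cdf per; rewrite /Rintegral integral_torus_measure//.
rewrite -integral21_prod_meas1; last exact: integrable_cell.
rewrite integral0_eq// => y _; rewrite /fubini_G.
have [Iy|Iy] := boolP (y \in I); last first.
  rewrite integral0_eq// => x _.
  by rewrite patchE mem_torus_cell (negbTE Iy) andbF.
rewrite -(@integral_line_derive f (0, y) (1, 0))//; last first.
  by rewrite line1; have [-> _] := per (0, y).
rewrite [RHS]integral_mkcond; apply: eq_integral => x _.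
rewrite !patchE mem_torus_cell Iy andbT; case: ifP => // _ /=.
rewrite /partial1 line1; congr ('D_(1, 0) f _)%:E.
by congr pair; rewrite /= ?add0r ?addr0.
Qed.

Lemma integral_partial2 (f : R * R -> R) : continuous f ->
  (forall y, derivable f y (0, 1)) -> continuous (partial2 f) ->
  doubly_periodic f -> \int[tau]_x partial2 f x = 0.
Proof.
move=> cf df cdf per; rewrite /Rintegral integral_torus_measure//.
rewrite -integral12_prod_meas1; last exact: integrable_cell.
rewrite integral0_eq// => x _; rewrite /fubini_F.
have [Ix|Ix] := boolP (x \in I); last first.
  rewrite integral0_eq// => y _.
  by rewrite patchE mem_torus_cell (negbTE Ix) andFb.
rewrite -(@integral_line_derive f (x, 0) (0, 1))//; last first.
  by rewrite line2; have [_ ->] := per (x, 0).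
rewrite [RHS]integral_mkcond; apply: eq_integral => y _.
rewrite !patchE mem_torus_cell Ix andTb; case: ifP => // _ /=.
rewrite /partial2 line2; congr ('D_(0, 1) f _)%:E.
by congr pair; rewrite /= ?add0r ?addr0.
Qed.


(** A wave with [k] nonzero is a partial derivative, in a direction in which [k]
    has a nonzero component, of a multiple of a wave. *)
Lemma integral_wave_eq0 k th : k != (0, 0) -> \int[tau]_x wave k th x = 0.
Proof.
case: k => k1 k2 k0; set k := (k1, k2).
pose w (c : R) := (fun x => c * wave k (th - pi / 2) x).
have [z1|z1] := eqVneq k1 0; last first.
  have <- : \int[tau]_x partial1 (w k1%:~R^-1) x = \int[tau]_x wave k th x.
    rewrite partial1_wave subrK mulVf ?intr_eq0//.
    by apply: eq_Rintegral => x _; rewrite mul1r.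
  have /(_ [::])[cw dw] := smooth_wave (k1%:~R^-1 : R) k (th - pi / 2).
  have /(_ [:: true])[cdw _] := smooth_wave (k1%:~R^-1 : R) k (th - pi / 2).
  apply: (@integral_partial1 (w k1%:~R^-1) cw _ cdw) => [y|].
    exact: (dw y).1.
  by move=> x; rewrite /w; have [-> ->] := @wave_periodic R k (th - pi / 2) x.
have {k0 z1}z2 : k2 != 0 by apply: contraNneq k0 => ->; rewrite z1.
have <- : \int[tau]_x partial2 (w k2%:~R^-1) x = \int[tau]_x wave k th x.
  rewrite partial2_wave subrK mulVf ?intr_eq0//.
  by apply: eq_Rintegral => x _; rewrite mul1r.
have /(_ [::])[cw dw] := smooth_wave (k2%:~R^-1 : R) k (th - pi / 2).
have /(_ [:: false])[cdw _] := smooth_wave (k2%:~R^-1 : R) k (th - pi / 2).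
apply: (@integral_partial2 (w k2%:~R^-1) cw _ cdw) => [y|].
  exact: (dw y).2.
by move=> x; rewrite /w; have [-> ->] := @wave_periodic R k (th - pi / 2) x.
Qed.

Lemma bounded_Lfun2 (f : plane -> R) (M : R) : measurable_fun setT f ->
  (forall x, `|f x| <= M) -> f \in Lfun tau 2%:R%:E.
Proof.
move=> mf fM; rewrite inE; apply/andP; split; rewrite inE//=.
rewrite /finite_norm unlock poweR_lty//.
have M2 x : `|f x ^+ 2| <= M ^+ 2.
  by rewrite normrX lerXn2r ?nnegrE// (le_trans _ (fM x)).
have mf2 : measurable_fun setT (fun x => f x ^+ 2) by exact: measurable_funX.
have /integrableP[_] := integrable_bounded mf2 M2.
apply: le_lt_trans; rewrite le_eqVlt; apply/orP; left; apply/eqP.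
apply: eq_integral => x _ /=; rewrite powR_mulrn//.
by rewrite normrX.
Qed.

End PeriodicPartials.

(** * Shear currents along a resonant direction *)

Section Shear.
Context (R : realType).
Local Notation plane := (measurableTypeR R * measurableTypeR R)%type.
Local Notation tau := (@torus_measure R).

Lemma is_derive_mul (f g : R * R -> R) x v df dg :
  is_derive x v f df -> is_derive x v g dg ->
  is_derive x v (fun y => f y * g y) (f x * dg + g x * df).
Proof. by move=> hf hg; apply: (@is_deriveM _ _ f g). Qed.

Lemma wave_sqr k (x : R * R) :
  wave k 0 x * wave k 0 x = 2^-1 * wave (k + k) 0 x + 2^-1.
Proof.
by rewrite wave_mul subrr subr0 addr0 wave00 /= cos0 mulr1.
Qed.

(** The integral of [cos^2 (k . x) = 1/2 + cos (2 k . x) / 2] is half the area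
    of the cell. *)
Lemma wave_neq0_ae k : k != (0, 0) -> ~ (wave k 0 = cst 0 %[ae tau]).
Proof.
move=> k0 w0.
have mw l := @measurable_wave R l 0.
have iw l : tau.-integrable setT (EFin \o (wave l (0 : R))).
  by apply: (integrable_bounded (mw l)); exact: wave_norm_le1.
have kk0 : k + k != (0, 0).
  case: k k0 {w0} => k1 k2; rewrite /= !xpair_eqE /=.
  by rewrite -!mulr2n !mulrn_eq0.
have : \int[tau]_x (wave k 0 x * wave k 0 x) = 0 :> R.
  rewrite (@Rintegral_ae_eq R _ (cst 0)).
  - by rewrite /Rintegral integral0.
  - by apply: measurable_funM; exact: mw.
  - exact: measurable_cst.
  - apply: (@filterS _ _ (ae_filter_ringOfSetsType tau) _ _ _ w0).
    by move=> x /(_ I) -> _; rewrite mul0r.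
under eq_Rintegral do rewrite wave_sqr.
have i1 : tau.-integrable setT (EFin \o (fun x => 2^-1 * wave (k + k) 0 x)).
  by have := integrableZl measurableT (2^-1 : R) (iw (k + k)).
have i2 : tau.-integrable setT (EFin \o (fun=> 2^-1 : R)).
  by apply: (@integrable_bounded R _ (2^-1)) => // x; rewrite ger0_norm.
rewrite (RintegralD measurableT i1 i2) (RintegralZl _ measurableT (iw (k + k))).
rewrite integral_wave_eq0// mulr0 add0r Rintegral_cst//.
have -> : fine (tau setT) = (2 * pi) * (2 * pi) by rewrite torus_measureT.
by apply/eqP; rewrite !mulf_neq0// gt_eqF ?pi_gt0.
Qed.

(** Since [k . n = 0], the integrand is [n . grad (wave phi)], a combination of
    partial derivatives of a periodic function. *)
Lemma integral_wave_transport k (n : R * R) (phi : R * R -> R) :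
  dot (lattice_vec R k) n = 0 -> smooth phi -> doubly_periodic phi ->
  \int[tau]_x (wave k 0 x * (n.1 * partial1 phi x + n.2 * partial2 phi x)) = 0.
Proof.
move=> kn sphi per.
have waveE th : wave k th = (fun y => 1 * wave k th y) :> (R * R -> R).
  by apply/funext => y; rewrite mul1r.
have w1E (x v : R * R) : is_derive x v (wave k 0 : R * R -> R)
    (dot (lattice_vec R k) v * wave k (0 + pi / 2) x).
  rewrite [in X in is_derive _ _ X]waveE; apply: is_derive_eq.
    exact: is_derive_wave.
  by rewrite mul1r.
have cw th : continuous (wave k th : R * R -> R).
  by rewrite waveE; exact: continuous_wave.
have [cphi dphi] := sphi [::].
have [c1 _] := sphi [:: true]; have [c2 _] := sphi [:: false].
pose psi x := wave k 0 x * phi x.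
have d1 (x : R * R) : is_derive x ((1, 0) : R * R) psi
    (wave k 0 x * partial1 phi x + phi x * (k.1%:~R * wave k (0 + pi / 2) x)).
  apply: is_derive_mul; last exact: DeriveDef (dphi x).1 erefl.
  by have := w1E x (1, 0); rewrite /dot /= mulr1 mulr0 addr0.
have d2 (x : R * R) : is_derive x ((0, 1) : R * R) psi
    (wave k 0 x * partial2 phi x + phi x * (k.2%:~R * wave k (0 + pi / 2) x)).
  apply: is_derive_mul; last exact: DeriveDef (dphi x).2 erefl.
  by have := w1E x (0, 1); rewrite /dot /= mulr1 mulr0 add0r.
have p1E : partial1 psi = (fun x => wave k 0 x * partial1 phi x +
    phi x * (k.1%:~R * wave k (0 + pi / 2) x)).
  by apply/funext => x; have [_ <-] := d1 x.
have p2E : partial2 psi = (fun x => wave k 0 x * partial2 phi x +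
    phi x * (k.2%:~R * wave k (0 + pi / 2) x)).
  by apply/funext => x; have [_ <-] := d2 x.
have cpsi : continuous psi by move=> x; apply: cvgM; [exact: cw|exact: cphi].
have cp1 : continuous (partial1 psi).
  rewrite p1E => x; apply: cvgD; apply: cvgM.
  - exact: cw.
  - exact: c1.
  - exact: cphi.
  - by apply: cvgM; [exact: cvg_cst|exact: cw].
have cp2 : continuous (partial2 psi).
  rewrite p2E => x; apply: cvgD; apply: cvgM.
  - exact: cw.
  - exact: c2.
  - exact: cphi.
  - by apply: cvgM; [exact: cvg_cst|exact: cw].
have ppsi : doubly_periodic psi.
  move=> x; have [e1 e2] := per x; have [f1 f2] := @wave_periodic R k 0 x.
  by rewrite /psi e1 e2 f1 f2.
have I1 : \int[tau]_x partial1 psi x = 0.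
  apply: (integral_partial1 cpsi _ cp1 ppsi) => y.
  exact: (@ex_derive _ _ _ _ _ _ _ (d1 y)).
have I2 : \int[tau]_x partial2 psi x = 0.
  apply: (integral_partial2 cpsi _ cp2 ppsi) => y.
  exact: (@ex_derive _ _ _ _ _ _ _ (d2 y)).
have i1 := continuous_torus_integrable cp1.
have i2 := continuous_torus_integrable cp2.
have iZ (c : R) (f : plane -> R) : tau.-integrable setT (EFin \o f) ->
    tau.-integrable setT (EFin \o (fun x => c * f x)).
  by move=> i; have := integrableZl measurableT c i.
transitivity (\int[tau]_x (n.1 * partial1 psi x + n.2 * partial2 psi x)).
  apply: eq_Rintegral => x _; rewrite p1E p2E.
  move: kn; rewrite /dot /= => kn.
  transitivity (wave k 0 x * (n.1 * partial1 phi x + n.2 * partial2 phi x) +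
      phi x * wave k (0 + pi / 2) x * (k.1%:~R * n.1 + k.2%:~R * n.2));
    last by ring.
  by rewrite kn mulr0 addr0.
rewrite (RintegralD measurableT (iZ n.1 _ i1) (iZ n.2 _ i2)).
rewrite (RintegralZl _ measurableT i1) (RintegralZl _ measurableT i2).
by rewrite I1 I2 !mulr0 addr0.
Qed.

(** The current is [cos (k . x) n]. *)
Lemma shear_current (a : R * R) k : a.1 ^+ 2 + a.2 ^+ 2 = 1 ->
  k != (0, 0) -> dot (lattice_vec R k) (perp a) = 0 ->
  exists e : L2torus R * L2torus R,
    [/\ Hspace e, e <> field0 R & dir_proj a e = cst 0 %[ae tau]].
Proof.
move=> ha k0 kn; set n := perp a in kn.
have mf (c : R) : measurable_fun setT (fun x : plane => c * wave k 0 x).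
  by apply: measurable_funM; [exact: measurable_cst|exact: measurable_wave].
have Lf (c : R) : (fun x : plane => c * wave k 0 x) \in Lfun tau 2%:R%:E.
  apply: (bounded_Lfun2 (M := `|c|) (mf c)) => x.
  by rewrite normrM ler_piMr// wave_norm_le1.
have fE c : {ae tau, forall x, to_L2 (Lf c) x = c * wave k 0 x}.
  by apply: filterS (L2_class_ae (Lf c)) => x /(_ I).
have iw : tau.-integrable setT (EFin \o (wave k (0 : R))).
  apply: (@integrable_bounded R _ 1); first exact: measurable_wave.
  exact: wave_norm_le1.
have mz c : \int[tau]_x to_L2 (Lf c) x = 0.
  rewrite (Rintegral_ae_eq (measurable_L2 (to_L2 (Lf c))) (mf c)).
    by rewrite RintegralZl// integral_wave_eq0// mulr0.
  by apply: filterS (fE c) => x xE _.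
exists (to_L2 (Lf n.1), to_L2 (Lf n.2)); split.
- split; last by split; exact: mz.
  move=> phi sphi per; rewrite -[RHS](integral_wave_transport kn sphi per).
  have [/continuous_plane_measurable mp1 _] := sphi [:: true].
  have [/continuous_plane_measurable mp2 _] := sphi [:: false].
  have m1 := measurable_L2 (to_L2 (Lf n.1)).
  have m2 := measurable_L2 (to_L2 (Lf n.2)).
  apply: Rintegral_ae_eq.
  + exact: (measurable_funD (measurable_funM m1 mp1) (measurable_funM m2 mp2)).
  + apply: measurable_funM; first exact: measurable_wave.
    exact: (measurable_funD (measurable_funM (measurable_cst n.1) mp1)
                            (measurable_funM (measurable_cst n.2) mp2)).
  + apply: filterS2 (fE n.1) (fE n.2) => x /= -> -> _; ring.
- move=> e0; apply: (wave_neq0_ae k0).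
  have z0 : {ae tau, forall x, L2_0 tau x = 0}.
    by apply: filterS (L2_0_ae R) => x /(_ I).
  have z1 := fE n.1; have z2 := fE n.2.
  have [E1 E2] : to_L2 (Lf n.1) = L2_0 tau /\ to_L2 (Lf n.2) = L2_0 tau.
    by split; [exact: (congr1 fst e0)|exact: (congr1 snd e0)].
  rewrite E1 in z1; rewrite E2 in z2.
  apply: filterS3 z0 z1 z2 => x /= -> w1 w2 _.
  transitivity ((a.1 ^+ 2 + a.2 ^+ 2) * wave k 0 x); first by rewrite ha mul1r.
  transitivity (- a.2 * (n.1 * wave k 0 x) + a.1 * (n.2 * wave k 0 x)).
    by rewrite /n /perp /=; ring.
  by rewrite -w1 -w2 !mulr0 addr0.
- apply: filterS2 (fE n.1) (fE n.2) => x /= e1 e2 _.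
  by rewrite /dir_proj /= e1 e2 /n /perp /=; ring.
Qed.

End Shear.

(** * Lattice vectors and slopes *)

Section Arithmetic.
Context (R : realType).

Lemma lattice_vec_neq0 (k : int * int) : k <> (0, 0) ->
  (k.1%:~R : R) ^+ 2 + k.2%:~R ^+ 2 != 0.
Proof.
move=> k0; rewrite paddr_eq0 ?sqr_ge0// !sqrf_eq0 !intr_eq0.
apply/negP => /andP[/eqP k1 /eqP k2]; apply: k0.
by rewrite [k]surjective_pairing k1 k2.
Qed.

(** A vector orthogonal to [k] is a multiple of the quarter turn of [k], itself
    a lattice vector; the unit length of [n] makes the factor nonzero. *)
Lemma resonant_parallel (n : R * R) : n.1 ^+ 2 + n.2 ^+ 2 = 1 ->
  forall k : int * int, k <> (0, 0) -> dot (lattice_vec R k) n = 0 ->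
  parallel n (lattice_vec R (- k.2, k.1)).
Proof.
move=> n1 k k0; rewrite /dot /= => kn.
have N0 := lattice_vec_neq0 k0.
set N := (_ + _) in N0.
(* n = ((n . k') / |k|^2) k' where k' = (- k.2, k.1) *)
pose s := k.1%:~R * n.2 - k.2%:~R * n.1.
have e1 : n.1 = s / N * (- k.2)%:~R.
  apply: (mulIf N0); rewrite mulrAC divfK// rmorphN /=.
  transitivity (- s * k.2%:~R + k.1%:~R * (k.1%:~R * n.1 + k.2%:~R * n.2)).
    by rewrite /N /s; ring.
  by rewrite kn mulr0 addr0 mulrN mulNr.
have e2 : n.2 = s / N * k.1%:~R.
  apply: (mulIf N0); rewrite mulrAC divfK//.
  transitivity (s * k.1%:~R + k.2%:~R * (k.1%:~R * n.1 + k.2%:~R * n.2)).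
    by rewrite /N /s; ring.
  by rewrite kn mulr0 addr0.
exists (s / N); last by rewrite [LHS]surjective_pairing e1 e2.
apply: contra_eq_neq n1 => c0; rewrite e1 e2 c0 !mul0r expr0n addr0.
by rewrite eq_sym oner_neq0.
Qed.

Lemma parallel_resonant (n : R * R) (k : int * int) :
  parallel n (lattice_vec R k) -> dot (lattice_vec R (- k.2, k.1)) n = 0.
Proof.
by move=> [c _ ->]; rewrite dotZr /dot /= rmorphN /=; ring.
Qed.

Lemma irrational_nonresonant (n : R * R) : irrational_slope n ->
  forall k : int * int, k <> (0, 0) -> dot (lattice_vec R k) n <> 0.
Proof.
move=> [/eqP n1 irr] [k1 k2] k0; rewrite /dot /= => kn.
have [k20|k20] := eqVneq k2 0.
  move: kn; rewrite k20 mul0r addr0 => /eqP.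
  rewrite mulf_eq0 (negbTE n1) orbF intr_eq0 => /eqP k10.
  by apply: k0; rewrite k10 k20.
apply: irr; exists (- k1%:~R / k2%:~R) => //.
rewrite rmorphM /= fmorphV rmorphN /= !ratr_int.
have k2R : k2%:~R != 0 :> R by rewrite intr_eq0.
apply: (mulIf n1); rewrite divfK//; apply: (mulIf k2R).
rewrite mulrAC divfK//; apply/eqP; rewrite -subr_eq0; apply/eqP.
by rewrite -[RHS]oppr0 -kn; ring.
Qed.

Lemma rational_resonant (n : R * R) : rational_slope n ->
  exists2 k : int * int, k != (0, 0) & dot (lattice_vec R k) n = 0.
Proof.
move=> [n1|[q _ qE]].
  by exists (1, 0) => //; rewrite /dot /= n1 mulr0 mul0r addr0.
have [n1|n1] := eqVneq n.1 0.
  by exists (1, 0) => //; rewrite /dot /= n1 mulr0 mul0r addr0.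
exists (- numq q, denq q); first by rewrite xpair_eqE negb_and denq_eq0 orbT.
have {}qE : n.2 = (numq q)%:~R / (denq q)%:~R * n.1.
  by rewrite -[X in X * _]/(ratr q) qE divfK.
have d0 : (denq q)%:~R != 0 :> R by rewrite intr_eq0 denq_eq0.
by rewrite /dot /= qE rmorphN /=; field.
Qed.

End Arithmetic.

Theorem proposition6p3 (R : realType) (a : R * R)
    (ha : a.1 ^+ 2 + a.2 ^+ 2 = 1) :
  let n := perp a in
  [/\ kernel_free a <->
        (forall k : int * int, k <> (0, 0) -> dot (lattice_vec R k) n <> 0),
      (forall k : int * int, k <> (0, 0) -> dot (lattice_vec R k) n <> 0) <->
        (forall k : int * int, k <> (0, 0) -> ~ parallel n (lattice_vec R k)),
      irrational_slope n -> kernel_free a &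
      rational_slope n ->
        exists e : L2torus R * L2torus R,
          [/\ Hspace e, e <> field0 R &
              dir_proj a e = cst 0 %[ae @torus_measure R]]].
Proof.
move=> n.
have hn : n.1 ^+ 2 + n.2 ^+ 2 = 1 by rewrite /n /perp /= sqrrN addrC.
have rot_neq0 (k : int * int) :
    k <> (0, 0) -> ((- k.2, k.1) : int * int) <> (0, 0).
  case: k => k1 k2 /= k0 [/eqP]; rewrite oppr_eq0 => /eqP k20 k10.
  by apply: k0; rewrite k10 k20.
have kerfree :
    (forall k : int * int, k <> (0, 0) -> dot (lattice_vec R k) n <> 0) ->
    kernel_free a.
  move=> nonres; apply/seteqP; split => [e|e ->]; last exact: field0_ker_proj.
  exact: ker_proj_eq0.
split.
- split=> // kf k /eqP k0 kn.
  have [e [He e0 ea]] := shear_current ha k0 kn.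
  by apply: e0; have : ker_proj a e by []; rewrite kf.
- split=> [nonres k k0 /parallel_resonant|npar k k0 kn].
    exact/nonres/rot_neq0.
  exact: npar (rot_neq0 k k0) (resonant_parallel hn k0 kn).
- by move=> irr; apply: kerfree; exact: irrational_nonresonant.
- by move=> /rational_resonant[k k0 kn]; exact: (shear_current ha k0 kn).
Qed.
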